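(* Let $q,r$ be real piecewise continuous functions on $[a,b]$ such that the Dirichlet problem $-y''+q(x)y=\lambda r(x)y$, $y(a)=y(b)=0$ is non-definite, and let $y=\varphi+i\psi$ ($\varphi={\rm Re}\,y$, $\psi={\rm Im}\,y$) be a complex ghost belonging to a non-real eigenvalue $\lambda$ with ${\rm Im}\,\lambda>0$. Put $G(x)=\int_a^x r|y|^2\,dt$ and suppose $G(x)<0$ for all $x\in(a,b)$. Suppose $\varphi'(b)<0$ (resp. $\varphi'(b)>0$) and that $\varphi$ has a zero in $(a,b)$; let $x_0\in(a,b)$ be the largest zero of $\varphi$ in $(a,b)$. (1) If $\psi'(b)>0$, then $\psi(x)<0$ in $(x_0,b)$ (resp. if $\psi'(b)<0$, then $\psi(x)>0$ in $(x_0,b)$). (2) If $\psi'(b)<0$, then $\psi$ vanishes exactly once in $(x_0,b)$ (resp. if $\psi'(b)>0$, then $\psi$ vanishes exactly once in $(x_0,b)$). (3) If $\psi'(b)=0$, then the conclusion of one of the first two cases must occur, i.e. either $\psi<0$ in $(x_0,b)$ (resp. $\psi>0$ in $(x_0,b)$), or $\psi$ vanishes exactly once in $(x_0,b)$.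
   Context: The problem is called non-definite if each of the quadratic forms $y\mapsto\int_a^b(|y'|^2+q|y|^2)\,dx$ and $y\mapsto\int_a^b r|y|^2\,dx$ takes both positive and negative values on the domain of the Dirichlet problem. Solutions are $C^1$ functions with absolutely continuous derivative satisfying the equation almost everywhere. A complex ghost is a non-trivial eigenfunction belonging to a non-real eigenvalue. In the claim, the ''resp.'' alternatives refer to the hypothesis $\varphi'(b)>0$. *)

(* Defs.v *)
From HB Require Import structures.
From mathcomp Require Import all_boot all_order all_algebra complex.
From mathcomp Require Import all_classical all_reals all_analysis.
Import Order.TTheory GRing.Theory Num.Theory numFieldNormedType.Exports.
Import ComplexField.Normc.

Set Implicit Arguments.
Unset Strict Implicit.
Unset Printing Implicit Defensive.

Local Open Scope classical_set_scope.
Local Open Scope ring_scope.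
Local Open Scope complex_scope.

Section RealFunctions.
Context {R : realType}.
Implicit Types (a b x : R) (f : R -> R).

(* The exceptional points form the finite sequence s; the one-sided limits are
   required to be finite, and the values at the exceptional points are free. *)
Definition piecewise_continuous a b f : Prop :=
  [/\ exists s : seq R,
        forall x, x \in `]a, b[ -> x \notin s -> {for x, continuous f},
      forall x, x \in `[a, b[ -> cvg (f t @[t --> x^'+]) &
      forall x, x \in `]a, b] -> cvg (f t @[t --> x^'-])].

(* Derivatives relative to [a, b]: one-sided at the end points, so that the
   values of f outside [a, b] are irrelevant. *)
Definition derivable_on a b f x : Prop :=
  cvg ((f t - f x) / (t - x) @[t --> within `[a, b] x^']).

Definition deriv_on a b f x : R :=
  lim ((f t - f x) / (t - x) @[t --> within `[a, b] x^']).

Definition abs_continuous a b f : Prop :=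
  forall e : R, 0 < e -> exists2 d : R, 0 < d &
    forall (n : nat) (u v : 'I_n -> R),
      (forall i, [/\ a <= u i, u i <= v i & v i <= b]) ->
      trivIset setT (fun i => [set` `]u i, v i[]) ->
      \sum_(i < n) (v i - u i) < d ->
      \sum_(i < n) `|f (v i) - f (u i)| < e.

Definition C1_AC a b f : Prop :=
  [/\ forall x, x \in `[a, b] -> derivable_on a b f x,
      {within `[a, b], continuous (deriv_on a b f)} &
      abs_continuous a b (deriv_on a b f)].

Definition largest_zero a b f x : Prop :=
  [/\ x \in `]a, b[, f x = 0 &
      forall t, t \in `]a, b[ -> f t = 0 -> t <= x].

Definition negative_on a b f : Prop :=
  forall x, x \in `]a, b[ -> f x < 0.

Definition positive_on a b f : Prop :=
  forall x, x \in `]a, b[ -> 0 < f x.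

Definition vanishes_once a b f : Prop :=
  exists! x, (x \in `]a, b[) /\ f x = 0.

End RealFunctions.

Section DirichletProblem.
Context {R : realType}.
Local Notation mu := (@lebesgue_measure R).
Implicit Types (a b x : R) (q r : R -> R) (y : R -> R[i]) (lambda : R[i]).

Definition cderiv_on a b y x : R[i] :=
  deriv_on a b (fun t => complex.Re (y t)) x +i* deriv_on a b (fun t => complex.Im (y t)) x.

Definition cderivable_on a b y x : Prop :=
  derivable_on a b (fun t => complex.Re (y t)) x /\
  derivable_on a b (fun t => complex.Im (y t)) x.

Definition dirichlet_domain a b y : Prop :=
  [/\ C1_AC a b (fun x => complex.Re (y x)), C1_AC a b (fun x => complex.Im (y x)),
      y a = 0 & y b = 0].

Definition dirichlet_form a b q y : R :=
  \int[mu]_(x in `[a, b])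
    (normc (cderiv_on a b y x) ^+ 2 + q x * normc (y x) ^+ 2).

Definition weight_form a b r y : R :=
  \int[mu]_(x in `[a, b]) (r x * normc (y x) ^+ 2).

Definition takes_both_signs a b (Q : (R -> R[i]) -> R) : Prop :=
  (exists2 y, dirichlet_domain a b y & 0 < Q y) /\
  (exists2 y, dirichlet_domain a b y & Q y < 0).

Definition non_definite a b q r : Prop :=
  takes_both_signs a b (dirichlet_form a b q) /\
  takes_both_signs a b (weight_form a b r).

Definition satisfies_equation a b q r lambda y : Prop :=
  {ae mu, forall x, x \in `]a, b[ ->
    cderivable_on a b (cderiv_on a b y) x /\
    - cderiv_on a b (cderiv_on a b y) x + (q x)%:C * y x
      = lambda * (r x)%:C * y x}.

Definition eigenfunction a b q r lambda y : Prop :=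
  [/\ dirichlet_domain a b y, satisfies_equation a b q r lambda y &
      exists2 x, x \in `[a, b] & y x != 0].

Definition complex_ghost a b q r lambda y : Prop :=
  eigenfunction a b q r lambda y /\ complex.Im lambda != 0.

End DirichletProblem.

(* Main.v *)
(* The Wronskian W = phi psi' - phi' psi is absolutely continuous, vanishes at a
   and satisfies W' = - Im lambda * r |y|^2 almost everywhere, so
   W = - Im lambda * G > 0 on ]a, b[. Hence psi / phi, whose derivative is
   W / phi^2, increases on ]x0, b[ and tends to psi'(b) / phi'(b) at b, while
   W(x0) = - phi'(x0) psi(x0) > 0 gives the sign of psi at x0. When
   phi'(b) < 0, psi / phi starts from negative values, so psi < 0 if
   psi'(b) >= 0 and psi has exactly one zero if psi'(b) < 0. The case
   phi'(b) > 0 follows by applying this to - y. *)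
Require Import Defs.
From mathcomp Require Import all_boot all_order all_algebra complex.
From mathcomp Require Import all_classical all_reals all_analysis.
From mathcomp Require Import measurable_realfun.
From mathcomp Require Import ring lra.
Import Order.TTheory GRing.Theory Num.Theory numFieldNormedType.Exports.
Import ComplexField.Normc.

Local Open Scope classical_set_scope.
Local Open Scope ring_scope.
Local Open Scope complex_scope.

(** * Absolutely continuous functions with almost everywhere zero derivative *)

Lemma is_derive1_eps (R : realType) (f : R -> R) (x l : R) :
  is_derive x 1 f l <->
  forall e, 0 < e -> exists2 d, 0 < d & forall t, `|t - x| < d ->
    `|f t - f x - l * (t - x)| <= e * `|t - x|.
Proof.
split=> [/is_derive1_caratheodory[g [fg /cvgrPdist_le gx <-]] e e0|H].
  have /nbhs_ballP[d /= d0 Hd] := gx _ e0; exists d => // t tx.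
  rewrite fg -mulrBl normrM ler_wpM2r//.
  by rewrite distrC; apply: Hd; rewrite /ball/= distrC.
apply/is_derive1_caratheodory.
(* Carathéodory's slope function: the difference quotient, completed by [l] at [x]. The estimate to
   prove is exactly its continuity at [x]. *)
exists (fun t => if t == x then l else (f t - f x) / (t - x)); split.
- move=> z; case: eqVneq => [->|zx]; first by rewrite !subrr mulr0.
  by rewrite divfK// subr_eq0.
- apply/cvgrPdist_le => e e0; have [d d0 Hd] := H _ e0.
  apply/nbhs_ballP; exists d => //= t xt; rewrite eqxx.
  case: eqVneq => [_|tx]; first by rewrite subrr normr0 ltW.
  have tx0 : 0 < `|t - x| by rewrite normr_gt0 subr_eq0.
  rewrite -(ler_pM2r tx0) -normrM mulrBl divfK ?subr_eq0// distrC.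
  by apply: Hd; rewrite distrC.
- by rewrite eqxx.
Qed.

(** Compactness of the segment in the form of Cousin's lemma. The supremum of the points reachable
    from [a] is itself reachable, by gluing a nearby reachable interval to a local one, and the
    local hypothesis there would carry it further unless it equals [b]. *)
Lemma interval_induction (R : realType) (a b : R) (P : R -> R -> Prop) :
  a <= b ->
  (forall s m t, a <= s -> s <= m -> m <= t -> t <= b ->
    P s m -> P m t -> P s t) ->
  (forall x, a <= x -> x <= b -> exists2 e, 0 < e &
    forall s t, a <= s -> s <= x -> x <= t -> t <= b ->
      x - e < s -> t < x + e -> P s t) ->
  P a b.
Proof.
move=> ab Padd Ploc; pose E := [set x | a <= x <= b /\ P a x].
have Ea : E a.
  split; first by rewrite lexx ab.
  by have [e e0] := Ploc a (lexx a) ab; apply => //; lra.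
have ubE : ubound E b by move=> x [/andP[]].
have supE : has_sup E by split; [exists a|exists b].
have supb : sup E <= b by apply: ge_sup => //; exists a.
have asup : a <= sup E by apply: ub_le_sup => //; exists b.
have [e e0 He] := Ploc _ asup supb.
have [m Em mE] := sup_adherent e0 supE; have [/andP[am mb] Pam] := Em.
have mS : m <= sup E by apply: ub_le_sup => //; exists b.
(* This point lies strictly beyond [sup E] unless it is [b]; as it turns out to belong to [E], only
   [t = b] remains. *)
pose t := Order.min b (sup E + e / 2).
have St : sup E <= t by rewrite le_min supb; lra.
have tb : t <= b by rewrite ge_min lexx.
have Et : E t.
  split; first by rewrite tb (le_trans asup).
  apply: (Padd a m t) => //; first exact: le_trans St.
  by apply: He => //; rewrite /t gt_min; apply/orP; right; lra.
have tS : t <= sup E by apply: ub_le_sup => //; exists b.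
suff <- : t = b by case: Et.
apply/eqP; rewrite eq_le tb leNgt; apply/negP => tltb; move: tS tltb.
by rewrite /t minElt; case: ifP; lra.
Qed.

(* A Cousin-type argument avoids the Vitali covering theorem: intervals tagged
   at a point outside [N] contribute [e * (t - s)], and those tagged in [N] lie
   in [U] and are collected in [l]. *)
Lemma flat_or_small_cover (R : realType) (a b : R) (H : R -> R)
    (N U : set R) (e : R) :
  a <= b -> 0 < e -> open U -> N `<=` U ->
  (forall x, a <= x -> x <= b -> ~ N x -> is_derive x 1 H 0) ->
  exists l : seq (R * R),
    [/\ all (fun p => (a <= p.1) && (p.1 <= p.2) && (p.2 <= b)) l,
        pairwise (fun p p' => p.2 <= p'.1) l,
        ((\sum_(p <- l) (p.2 - p.1))%:E <=
          lebesgue_measure (U `&` `]a, b]%classic))%E &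
        `|H b - H a| <= e * (b - a) + \sum_(p <- l) `|H p.2 - H p.1|].
Proof.
move=> ab e0 oU NU HN.
apply: (interval_induction _ a b (fun s t => exists l : seq (R * R),
    [/\ all (fun p => (s <= p.1) && (p.1 <= p.2) && (p.2 <= t)) l,
        pairwise (fun p p' => p.2 <= p'.1) l,
        ((\sum_(p <- l) (p.2 - p.1))%:E <=
          lebesgue_measure (U `&` `]s, t]%classic))%E &
        `|H t - H s| <= e * (t - s) + \sum_(p <- l) `|H p.2 - H p.1|])) => //.
  move=> s m t _ sm mt _ [l1 [A1 P1 M1 D1]] [l2 [A2 P2 M2 D2]].
  exists (l1 ++ l2); split.
  - rewrite all_cat; apply/andP; split.
      apply: sub_all A1 => p /andP[/andP[-> ->] /= h]; exact: le_trans mt.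
    by apply: sub_all A2 => p /andP[/andP[h -> ->]]; rewrite (le_trans sm).
  - rewrite pairwise_cat P1 P2 !andbT; apply/allrelP => p p' /(allP A1) + /(allP A2).
    by move=> /andP[_ h] /andP[/andP[h' _] _]; exact: le_trans h'.
  (* Half-open intervals make the two pieces disjoint, so that their measures add up. *)
  - have -> : `]s, t]%classic = `]s, m]%classic `|` `]m, t]%classic.
      by rewrite -itv_bndbnd_setU// bnd_simp.
    rewrite setIUr measureU//.
    + by rewrite big_cat EFinD; exact: leeD.
    + by apply: measurableI => //; exact: open_measurable.
    + by apply: measurableI => //; exact: open_measurable.
    + apply/seteqP; split => // x /= [[_]]; rewrite !in_itv/= => /andP[_ xm] [_ /andP[]].
      by rewrite ltNge xm.
  - rewrite big_cat/=; have := ler_normD (H t - H m) (H m - H s).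
    have -> : H t - H m + (H m - H s) = H t - H s by ring.
    by move: D1 D2; lra.
(* Near a point of [N] the whole interval goes into the list; near any other point the list is empty
   and the zero derivative bounds the increment. *)
move=> x ax xb; have [Nx|/(HN _ ax xb) Hx] := pselect (N x).
  have /nbhs_ballP[d /= d0 Ud] : nbhs x U by apply: open_nbhs_nbhs; split => //; exact: NU.
  exists d => // s t _ sx xt _ ds td; exists [:: (s, t)]; split => //=.
  - by rewrite !lexx (le_trans sx).
  - rewrite big_seq1 /= (_ : _ `&` _ = `]s, t]%classic).
      by rewrite lebesgue_measure_itv/= lte_fin; case: ltP => // ts; rewrite lee_fin; lra.
    apply/setIidPr => z /=; rewrite in_itv/= => /andP[sz zt].
    by apply: Ud; rewrite /ball/= ltr_distlC; lra.
  - rewrite big_seq1 /= lerDr; apply: mulr_ge0; lra.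
have [d d0 Hd] := (is_derive1_eps _ _ _ _).1 Hx _ e0.
exists d => // s t _ sx xt _ ds td; exists [::]; split => //=.
  by rewrite big_nil.
rewrite big_nil addr0.
have := Hd s; have := Hd t; rewrite !mul0r !subr0 !ltr_distl.
rewrite (ger0_norm (_ : 0 <= t - x)) ?(ler0_norm (_ : s - x <= 0)); [|lra|lra].
move=> /(_ ltac:(lra)) h1 /(_ ltac:(lra)) h2.
have := ler_normB (H t - H x) (H s - H x).
have -> : H t - H x - (H s - H x) = H t - H s by ring.
lra.
Qed.

(** The exceptional null set is enclosed in an open set of measure less than the [d] given by
    absolute continuity. The intervals collected there contribute less than [e / 2] to the
    increment, and the flat ones at most [e / 2]. *)
Lemma abs_continuous_eq (R : realType) (a b : R) (H : R -> R) :
  a <= b -> abs_continuous a b H ->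
  {ae (@lebesgue_measure R), forall x, x \in `]a, b[ -> is_derive x 1 H 0} ->
  H b = H a.
Proof.
move=> ab acH [A [mA A0 HA]]; apply/eqP; rewrite -subr_eq0 -normr_le0.
apply/ler_addgt0Pr => e e0; rewrite add0r.
have e20 : 0 < e / 2 by lra.
have [d d0 Hd] := acH _ e20.
(* The end points join the exceptional set because the derivative is known only in the open
   interval. *)
pose N : set R := A `|` [set a; b].
have mN : measurable N by apply: measurableU => //; apply: measurableU.
have N0 : lebesgue_measure N = 0%E.
  rewrite measureU0//; first exact: measurableU.
  by rewrite measureU0//; exact: lebesgue_measure_set1.
have [|U [oU NU Ud]] := lebesgue_regularity_outer mN _ d0; first by rewrite [ltLHS]N0 ltry.
have mU : measurable U by exact: open_measurable.
(* Regularity bounds the measure of [U] minus [N]; the null set [N] adds nothing. *)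
have Ud' : (lebesgue_measure U < d%:E)%E.
  apply: le_lt_trans Ud; rewrite -[leRHS]adde0 -[X in (_ + X)%E]N0.
  apply: le_trans (measureU2 _ _ _) => //; last exact: measurableD.
  apply: le_measure; rewrite ?inE//; first by apply: measurableU => //; exact: measurableD.
  by move=> x Ux; case: (pselect (N x)); [right|left].
(* The slope for which flat intervals contribute at most [e / 2]; the added [1] keeps the
   denominator positive when [a = b]. *)
pose k := e / 2 / (b - a + 1).
have k0 : 0 < k by rewrite !divr_gt0//; lra.
have Nder x : a <= x -> x <= b -> ~ N x -> is_derive x 1 H 0.
  move=> ax xb Nx; have [|/HA Ax] := pselect (x \in `]a, b[ -> is_derive x 1 H 0).
    apply; rewrite in_itv/= !lt_neqAle ax xb !andbT.
    by apply/andP; split; apply/eqP => h; apply: Nx; right; rewrite h; [left|right].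
  by case: Nx; left.
have [l [Al Pl Ml Hl]] := flat_or_small_cover R a b H N U k ab k0 oU NU Nder.
have kab : k * (b - a) <= e / 2.
  rewrite /k -mulrA -[leRHS]mulr1 ler_wpM2l//; first by lra.
  by rewrite mulrC ler_pdivrMr; lra.
suff : \sum_(p <- l) `|H p.2 - H p.1| < e / 2 by lra.
pose z : R * R := (0, 0).
rewrite (big_nth z) big_mkord.
apply: (Hd _ (fun i => (nth z l i).1) (fun i => (nth z l i).2)).
- move=> i; have := allP Al (nth z l i) (mem_nth _ (ltn_ord i)).
  by move=> /andP[/andP[]].
(* Consecutive intervals of the list may share an end point, but their interiors are disjoint. *)
- have disj (i j : 'I_(size l)) : (i < j)%N ->
      `](nth z l i).1, (nth z l i).2[%classic `&`
      `](nth z l j).1, (nth z l j).2[%classic = set0.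
    move=> ij; have h := pairwiseP z Pl i j (ltn_ord i) (ltn_ord j) ij.
    apply/seteqP; split => // x [] /=; rewrite !in_itv/= => /andP[_ xi] /andP[jx _].
    by move: (lt_le_trans xi h); rewrite ltNge (ltW jx).
  apply/trivIsetP => i j _ _; case: (ltngtP i j) => [/disj//|/disj + _|/val_inj->].
    by rewrite setIC.
  by rewrite eqxx.
- rewrite -(big_mkord xpredT (fun i => (nth z l i).2 - (nth z l i).1)).
  rewrite -(big_nth z xpredT (fun p => p.2 - p.1)) -lte_fin.
  apply: le_lt_trans Ud'; apply: le_trans Ml _.
  by apply: le_measure; rewrite ?inE//; exact: measurableI.
Qed.

(** * Boundedness of piecewise continuous functions and their indefinite integrals *)

Lemma piecewise_continuous_bounded (R : realType) (a b : R) (f : R -> R) :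
  a < b -> piecewise_continuous a b f ->
  exists M : R, forall x, a <= x -> x <= b -> `|f x| <= M.
Proof.
move=> ab [_ fr fl].
apply: (interval_induction _ a b
  (fun s t => exists M : R, forall x, s <= x -> x <= t -> `|f x| <= M)).
- exact: ltW.
- move=> s m t _ _ _ _ [M1 H1] [M2 H2]; exists (Order.max M1 M2) => x sx xt.
  rewrite le_max; case: (leP x m) => xm; first by rewrite H1.
  by rewrite H2 ?orbT// ltW.
move=> x ax xb.
(* The right limit bounds [f] just after [x], and at [x = b] the claim is vacuous. The left side is
   symmetric, and the value at [x] enters the final maximum separately. *)
have [er er0 [Mr Hr]] : exists2 e, 0 < e & exists M : R, forall t,
    x < t -> t < x + e -> t <= b -> `|f t| <= M.
  have [xb'|bx] := ltP x b; last by exists 1 => //; exists 0 => t; lra.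
  have /cvg_ex[l /cvgrPdist_le /(_ _ ltr01)] := fr x ltac:(rewrite in_itv/=; lra).
  move=> /nbhs_ballP[e /= e0 He]; exists e => //.
  exists (`|l| + 1) => t xt te _.
  have := He t; rewrite /ball/= ltr_distlC => /(_ ltac:(lra) xt).
  have := ler_normD (f t - l) l; rewrite subrK distrC; lra.
have [el el0 [Ml Hl]] : exists2 e, 0 < e & exists M : R, forall t,
    t < x -> x - e < t -> a <= t -> `|f t| <= M.
  have [ax'|bx] := ltP a x; last by exists 1 => //; exists 0 => t; lra.
  have /cvg_ex[l /cvgrPdist_le /(_ _ ltr01)] := fl x ltac:(rewrite in_itv/=; lra).
  move=> /nbhs_ballP[e /= e0 He]; exists e => //.
  exists (`|l| + 1) => t xt te _.
  have := He t; rewrite /ball/= ltr_distlC => /(_ ltac:(lra) xt).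
  have := ler_normD (f t - l) l; rewrite subrK distrC; lra.
exists (Order.min er el); first by rewrite lt_min er0.
move=> s t as_ sx xt tb; rewrite -ltrBlDl ltrBlDl -ltrBlDl.
rewrite lt_min ltrBlDr -ltrBlDl lt_min => /andP[h1 h2] /andP[h3 h4].
exists (Order.max `|f x| (Order.max Mr Ml)) => z sz zt; rewrite !le_max.
case: (ltgtP z x) => [zx|xz|->]; last by rewrite lexx.
  by apply/orP; right; apply/orP; right; apply: Hl; lra.
by apply/orP; right; apply/orP; left; apply: Hr; lra.
Qed.

Section finite_discontinuities.
Context {R : realType} {a b M : R} {f : R -> R} {s : seq R}.
Hypothesis ab : a < b.
Hypothesis fc : forall x, x \in `]a, b[ -> x \notin s -> {for x, continuous f}.
Hypothesis fM : forall x, a <= x -> x <= b -> `|f x| <= M.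
Local Notation mu := (@lebesgue_measure R).

Lemma finite_discontinuities_integrable :
  mu.-integrable `[a, b] (EFin \o f).
Proof.
apply: measurable_bounded_integrable => //.
- by rewrite /= lebesgue_measure_itv/= lte_fin ab ltry.
(* Off these finitely many points the segment is open and [f] is continuous on it; on them
   measurability is trivial. *)
- pose s' := a :: b :: s.
  have ms : measurable [set` s'] /\ measurable_fun [set` s'] f.
    elim: s' => [|c s' [m1 m2]].
      rewrite (_ : [set` [::]] = set0); last by apply/seteqP; split.
      by split; [exact: measurable0|exact: measurable_fun_set0].
    have -> : [set` c :: s'] = c |` [set` s'].
      apply/seteqP; split => x /=; rewrite inE.
        by move=> /orP[/eqP|]; [left|right].
      by move=> [->|->]; rewrite ?eqxx ?orbT.
    split; first exact: measurableU.
    by apply/measurable_funU => //; split => //; exact: measurable_fun_set1.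
  have oD : open (`]a, b[%classic `\` [set` s']).
    apply: openI; first exact: interval_open.
    apply: closed_openC; apply: (accessible_finite_set_closed.1 _).
      exact/hausdorff_accessible/Rhausdorff.
    exact: finite_seq.
  apply: (measurable_funS _ _
    (_ : measurable_fun ((`]a, b[%classic `\` [set` s']) `|` [set` s']) f)).
  + by apply: measurableU ms.1; exact: open_measurable.
  + move=> x /=; rewrite in_itv/= => /andP[ax xb].
    have [xs|xs] := boolP (x \in s'); first by right.
    left; split; last exact/negP.
    move: xs; rewrite /= in_itv/= !inE !lt_neqAle ax xb !andbT => /norP[xa /norP[xb' _]].
    by rewrite eq_sym xa xb'.
  + apply/measurable_funU; [exact: open_measurable|exact: ms.1|split; last exact: ms.2].
    apply: open_continuous_measurable_fun => // x /set_mem [xab /= /negP xs].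
    by apply: fc => //; move: xs; rewrite !inE; apply: contra => ->; rewrite !orbT.
- exists M; split=> [|K /ltW MK x /=]; first exact: num_real.
  by rewrite in_itv/= => /andP[ax xb]; apply: le_trans MK; exact: fM.
Qed.

Let G x := \int[mu]_(t in `[a, x]) f t.

Lemma finite_discontinuities_lipschitz u v :
  a <= u -> u <= v -> v <= b -> `|G v - G u| <= M * (v - u).
Proof.
move=> au uv vb.
have Iv : mu.-integrable `[a, v] (EFin \o f).
  apply: integrableS finite_discontinuities_integrable => //.
  by apply: subset_itvl; rewrite bnd_simp.
have Iuv : mu.-integrable `]u, v] (EFin \o f).
  apply: integrableS Iv => //.
  by apply: subset_itvr; rewrite bnd_simp.
rewrite /G Rintegral_itvB ?bnd_simp//.
apply: le_trans (le_normr_Rintegral _ _) _ => //.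
apply: (@le_trans _ _ (\int[mu]_(t in `]u, v]) M)).
  apply: le_Rintegral => //.
  - exact: integrable_norm.
  - apply: measurable_bounded_integrable => //.
      by rewrite /= lebesgue_measure_itv/=; case: ifP; rewrite ltry.
    by exists `|M|; split=> [|K /ltW MK x _ //]; exact: num_real.
  - move=> x /=; rewrite in_itv/= => /andP[ux xv]; apply: fM; lra.
rewrite Rintegral_cst// [X in fine X](lebesgue_measure_itv `]u, v])/= lte_fin.
case: ltP => //= vu.
by have -> : v = u by [apply/eqP; rewrite eq_le vu]; rewrite subrr.
Qed.

(** The fundamental theorem of calculus at a point of continuity; this covers all but finitely many
    points of the open interval. *)
Lemma finite_discontinuities_is_derive x :
  x \in `]a, b[ -> x \notin s -> is_derive x 1 G (f x).
Proof.
move=> xab xs; have := xab; rewrite in_itv/= => /andP[ax xb].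
have [dG G'x] := continuous_FTC1_closed xb finite_discontinuities_integrable
  ax (fc _ xab xs).
by apply: (DeriveDef dG); rewrite -derive1E; exact: G'x.
Qed.

End finite_discontinuities.

(** * Derivatives relative to a segment *)

Section derivative_on_segment.
Context {R : realType} {a b : R}.
Hypothesis ab : a < b.
Implicit Types (f : R -> R) (x : R).

(** Properness makes the limit defining [deriv_on] unique. A non-degenerate segment has points
    arbitrarily close to [x] on at least one side: to the right if [x < b], to the left if
    [x = b]. *)
Lemma within_dnbhs_proper x :
  a <= x -> x <= b -> ProperFilter (within `[a, b] x^').
Proof.
have ltab := ab; move=> ax xb; split; last exact: within_filter.
rewrite /within/= => /nbhs_ballP[e /= e0 He].
have {}He t : `|t - x| < e -> t != x -> a <= t -> t <= b -> False.
  move=> tx tnx at_ tb; apply: (He t) => //=; last by rewrite in_itv/= at_ tb.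
  by rewrite /ball/= distrC.
have [xb'|bx] := ltP x b.
  have [m [m0 me mb]] : exists m, [/\ 0 < m, m < e & m <= b - x].
    exists (Order.min (e / 2) (b - x)); split; last by rewrite ge_min lexx orbT.
      by rewrite lt_min; lra.
    by rewrite gt_min; apply/orP; left; lra.
  apply: (He (x + m)); [|by rewrite gt_eqF// ltrDl|lra|lra].
  by rewrite addrAC subrr add0r gtr0_norm.
have [m [m0 me mb]] : exists m, [/\ 0 < m, m < e & m <= x - a].
  exists (Order.min (e / 2) (x - a)); split; last by rewrite ge_min lexx orbT.
    by rewrite lt_min; lra.
  by rewrite gt_min; apply/orP; left; lra.
apply: (He (x - m)); [|by rewrite lt_eqF// gtrBl|lra|lra].
by rewrite addrAC subrr add0r normrN gtr0_norm.
Qed.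

(** The first-order expansion, free of division and uniform over interior and end points; all later
    local estimates go through it. *)
Lemma derivable_on_eps f x : a <= x -> x <= b -> derivable_on a b f x ->
  forall e, 0 < e -> exists2 d, 0 < d & forall t, a <= t -> t <= b ->
    `|t - x| < d -> `|f t - f x - deriv_on a b f x * (t - x)| <= e * `|t - x|.
Proof.
move=> ax xb df e e0; have pF := @within_dnbhs_proper x ax xb.
have /cvgrPdist_le /(_ _ e0) : (f t - f x) / (t - x) @[t --> within `[a, b] x^']
  --> deriv_on a b f x by exact: df.
move=> /nbhs_ballP[d /= d0 Hd]; exists d => // t at_ tb tx.
have [->|tnx] := eqVneq t x; first by rewrite !subrr mulr0 subrr normr0 mulr0.
have tx0 : t - x != 0 by rewrite subr_eq0.
have -> : f t - f x - deriv_on a b f x * (t - x) =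
  ((f t - f x) / (t - x) - deriv_on a b f x) * (t - x) by field.
rewrite normrM ler_wpM2r// distrC; apply: Hd => //=; last by rewrite in_itv/= at_ tb.
by rewrite /ball/= distrC.
Qed.

Lemma derivable_on_is_derive f x : x \in `]a, b[ -> derivable_on a b f x ->
  is_derive x 1 f (deriv_on a b f x).
Proof.
rewrite in_itv/= => /andP[ax xb] df; apply/is_derive1_eps => e e0.
have [d d0 Hd] := derivable_on_eps f x (ltW ax) (ltW xb) df e e0.
(* The distances to the end points keep [t] inside the segment, so the relative derivative becomes
   an ordinary one. *)
exists (Order.min d (Order.min (x - a) (b - x))).
  by rewrite !lt_min d0; lra.
move=> t; rewrite !lt_min !ltr_distl => /andP[h1 /andP[h2 h3]].
by apply: Hd; rewrite ?ltr_distl; lra.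
Qed.

Lemma derivable_on_continuous f :
  (forall x, x \in `[a, b] -> derivable_on a b f x) ->
  {within `[a, b], continuous f}.
Proof.
move=> df; apply/subspace_continuousP => x /=; rewrite in_itv/= => /andP[ax xb].
apply/cvgrPdist_le => e e0.
have dfx : derivable_on a b f x by apply: df; rewrite in_itv/= ax.
have [d d0 Hd] := derivable_on_eps f x ax xb dfx 1 ltr01.
set l := deriv_on a b f x in Hd.
have l0 : 0 < 1 + `|l| by rewrite ltr_pwDl.
(* The expansion with tolerance [1] gives the local Lipschitz constant [1 + |l|] at [x]. *)
apply/nbhs_ballP; exists (Order.min d (e / (1 + `|l|))).
  by rewrite /= lt_min d0 divr_gt0.
move=> t; rewrite /ball/= lt_min ltr_pdivlMr// => /andP[h1 h2].
rewrite in_itv/= => /andP[at_ tb].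
have := Hd t at_ tb; rewrite distrC => /(_ h1); rewrite mul1r => h3.
have := ler_normD (f t - f x - l * (t - x)) (l * (t - x)).
rewrite subrK normrM [`|f x - f t|]distrC [`|t - x|]distrC; lra.
Qed.

Lemma difference_quotientN f x :
  (fun t => (- f t - - f x) / (t - x)) = - (fun t => (f t - f x) / (t - x)).
Proof. by apply/funext => t; rewrite !fctE -mulNr opprB opprK addrC. Qed.

Lemma deriv_onN f x : x \in `[a, b] -> derivable_on a b f x ->
  deriv_on a b (fun t => - f t) x = - deriv_on a b f x.
Proof.
rewrite in_itv/= => /andP[ax xb] df; have pF := within_dnbhs_proper x ax xb.
by rewrite /deriv_on difference_quotientN; exact: limN.
Qed.

Lemma derivable_onN f x : derivable_on a b f x ->
  derivable_on a b (fun t => - f t) x.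
Proof. by rewrite /derivable_on difference_quotientN; exact: is_cvgN. Qed.

End derivative_on_segment.

(** * A pair of functions with positive Wronskian, to the right of the largest zero of the first *)

Section quotient.
Context {R : realType} {a b : R} {f g : R -> R}.
Hypothesis ab : a < b.
Hypothesis df : forall x, x \in `[a, b] -> derivable_on a b f x.
Hypothesis dg : forall x, x \in `[a, b] -> derivable_on a b g x.
Local Notation f' := (deriv_on a b f).
Local Notation g' := (deriv_on a b g).
Hypotheses (fb : f b = 0) (gb : g b = 0).
Hypothesis W_gt0 : forall x, x \in `]a, b[ -> 0 < f x * g' x - f' x * g x.
Hypothesis f'b : f' b < 0.

(** Expansion at [b], where [h] vanishes: the graph lies between two lines through the end point.
    Here [b - t] is positive, whence the minus sign before the derivative. *)
Lemma near_right_end (h : R -> R) (e : R) : h b = 0 -> 0 < e ->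
  derivable_on a b h b ->
  exists2 c, a <= c < b & forall t, c < t -> t < b ->
    (- deriv_on a b h b - e) * (b - t) <= h t /\
    h t <= (- deriv_on a b h b + e) * (b - t).
Proof.
move=> hb e0 dh; have ltab := ab.
have [d d0 Hd] := derivable_on_eps ab h b (ltW ab) (lexx b) dh e e0.
exists (Order.max a (b - d)) => [|t].
  by rewrite le_max lexx gt_max ab; lra.
rewrite gt_max => /andP[at_ bt] tb; have := Hd t (ltW at_) (ltW tb).
rewrite hb ltr0_norm ?subr_lt0// opprB => /(_ ltac:(lra)).
rewrite ler_norml; lra.
Qed.

Lemma pos_near_right_end :
  exists2 c, a <= c < b & forall t, c < t -> t < b -> 0 < f t.
Proof.
have e0 : 0 < - f' b / 2 by move: f'b; lra.
have bab : b \in `[a, b] by rewrite in_itv/= (ltW ab) lexx.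
have [c cab Hc] := near_right_end f _ fb e0 (df b bab).
exists c => // t ct tb; have [+ _] := Hc t ct tb; apply: lt_le_trans.
by apply: mulr_gt0; move: f'b; lra.
Qed.

(** Zeros cannot accumulate at [b], since [f] is positive just before it. Their supremum is
    therefore interior, and it is a zero by continuity. *)
Lemma largest_zero_exists :
  (exists2 x, x \in `]a, b[ & f x = 0) -> exists x0, largest_zero a b f x0.
Proof.
move=> [x1 x1ab fx1]; have [c /andP[ac cb] Hc] := pos_near_right_end.
pose Z := [set x | (x \in `]a, b[) /\ f x = 0].
have Zc : ubound Z c.
  move=> x [xab fx]; rewrite leNgt; apply/negP => cx.
  have := Hc x cx; rewrite fx ltxx => H; suff : false by []; apply: H.
  by move: xab; rewrite in_itv/= => /andP[].
have hZ : has_sup Z by split; [exists x1|exists c].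
have le_s x : Z x -> x <= sup Z by apply: ub_le_sup; exists c.
have sc : sup Z <= c by apply: ge_sup => //; exists x1.
have x1s : x1 <= sup Z by apply: le_s.
have sab : sup Z \in `]a, b[.
  move: x1ab; rewrite !in_itv/= => /andP[ax1 _].
  by rewrite (lt_le_trans ax1 x1s) (le_lt_trans sc cb).
exists (sup Z); split => //; last by move=> t tab ft; exact: le_s.
apply/eqP/negPn/negP => fs0.
have fs : is_derive (sup Z) 1 f (f' (sup Z)).
  apply: derivable_on_is_derive => //; apply: df.
  exact: subset_itv_oo_cc sab.
have : {for sup Z, continuous f}.
  by apply/differentiable_continuous/derivable1_diffP; case: fs.
(* With tolerance [|f (sup Z)|], continuity excludes zeros near [sup Z], whereas zeros exist
   arbitrarily close to it. *)
move=> /cvgrPdist_lt /(_ (Num.norm (f (sup Z)))); rewrite normr_gt0 => /(_ fs0).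
move=> /nbhs_ballP[d /= d0 Hd].
have [z Zz sz] := sup_adherent d0 hZ.
have := Hd z; rewrite /ball/= Zz.2 subr0 ltxx ger0_norm ?subr_ge0 ?le_s//.
by move=> H; suff : false by []; apply: H; lra.
Qed.

Section after_largest_zero.
Context {x0 : R}.
Hypothesis x0P : largest_zero a b f x0.

Let x0ab : (a < x0) && (x0 < b).
Proof. by case: x0P; rewrite in_itv. Qed.

Let fx0 : f x0 = 0. Proof. by case: x0P. Qed.

Let fc : {within `[a, b], continuous f}.
Proof. exact: derivable_on_continuous. Qed.

Let gc : {within `[a, b], continuous g}.
Proof. exact: derivable_on_continuous. Qed.

Lemma pos_after_largest_zero t : x0 < t -> t < b -> 0 < f t.
Proof.
move=> x0t tb; have /andP[ax0 x0b] := x0ab; have [_ _ x0max] := x0P.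
have [c /andP[ac cb] Hc] := pos_near_right_end.
rewrite ltNge; apply/negP => ft.
(* A point beyond both [t] and [c], where [f] is positive; a value [f t <= 0] would then force a
   zero larger than [x0]. *)
pose u := (Order.max t c + b) / 2.
have tu : t < u.
  by rewrite /u; have : t <= Order.max t c; [rewrite le_max lexx|lra].
have cu : c < u.
  by rewrite /u; have : c <= Order.max t c; [rewrite le_max lexx orbT|lra].
have ub : u < b.
  by rewrite /u; have : Order.max t c < b; [rewrite gt_max tb|lra].
have fu := Hc u cu ub.
have [||z] := @IVT R f t u 0 (ltW tu).
- apply: continuous_subspaceW fc => x /=; rewrite !in_itv/=; lra.
- by rewrite ge_min le_max ft (ltW fu) orbT.
rewrite in_itv/= => /andP[tz zu] fz.
have := x0max z _ fz; rewrite in_itv/= => /(_ ltac:(lra)); lra.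
Qed.

(** Positivity of [f] after its zero [x0] forces [f' x0 >= 0], and the Wronskian there reduces to
    [- f' x0 * g x0 > 0]. *)
Lemma other_neg_at_largest_zero : g x0 < 0.
Proof.
have /andP[ax0 x0b] := x0ab.
have f'x0 : 0 <= f' x0.
  rewrite leNgt; apply/negP => h.
  have x0ab' : x0 \in `[a, b] by rewrite in_itv/= !ltW.
  (* Half the supposed negative slope: the expansion then gives
     [f (x0 + m) <= f' x0 / 2 * m < 0]. *)
  have e0 : 0 < - f' x0 / 2 by lra.
  have [d d0 Hd] := derivable_on_eps ab f x0 (ltW ax0) (ltW x0b) (df _ x0ab') _ e0.
  have [m [m0 md mb]] : exists m, [/\ 0 < m, m < d & m < b - x0].
    exists (Order.min (d / 2) ((b - x0) / 2)); split.
    - by rewrite lt_min; lra.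
    - by rewrite gt_min; apply/orP; left; lra.
    - by rewrite gt_min; apply/orP; right; lra.
  have := Hd (x0 + m); rewrite addrAC subrr add0r gtr0_norm// fx0 subr0.
  have fm := pos_after_largest_zero (x0 + m) ltac:(lra) ltac:(lra).
  move=> /(_ ltac:(lra) ltac:(lra) md); rewrite ler_norml => /andP[_].
  by nra.
have := W_gt0 x0; rewrite in_itv/= ax0 x0b fx0 mul0r sub0r oppr_gt0 => /(_ isT).
by nra.
Qed.

Lemma quotient_increasing u v : x0 < u -> u < v -> v < b ->
  g u / f u < g v / f v.
Proof.
move=> x0u uv vb; have /andP[ax0 x0b] := x0ab.
have fpos x : u <= x -> x <= v -> 0 < f x.
  by move=> ux xv; apply: pos_after_largest_zero; lra.
pose h x := g x * (f x)^-1.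
pose h' x := (f x * g' x - f' x * g x) / f x ^+ 2.
have dh x : u <= x -> x <= v -> is_derive x 1 h (h' x).
  move=> ux xv.
  have xab : x \in `]a, b[ by rewrite in_itv/=; lra.
  have fx0' : f x != 0 by rewrite gt_eqF ?fpos.
  have Df : is_derive x 1 f (f' x).
    by apply: derivable_on_is_derive => //; apply: df; exact: subset_itv_oo_cc xab.
  have Dg : is_derive x 1 g (g' x).
    by apply: derivable_on_is_derive => //; apply: dg; exact: subset_itv_oo_cc xab.
  have Dfi := is_deriveV fx0' Df.
  apply: is_derive_eq; rewrite /h' /GRing.scale/= -exprVn; field.
  exact: fx0'.
have [||z] := @MVT R h h' u v uv.
- by move=> x; rewrite in_itv/= => /andP[ux xv]; apply: dh; exact: ltW.
- apply: derivable_within_continuous => x; rewrite in_itv/= => /andP[ux xv].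
  by have [] := dh x ux xv.
rewrite in_itv/= => /andP[uz zv]; rewrite -/(h u) -/(h v) -subr_gt0 => ->.
rewrite mulr_gt0 ?subr_gt0// divr_gt0//; first by apply: W_gt0; rewrite in_itv/=; lra.
by apply/exprn_gt0/fpos; exact: ltW.
Qed.

(** If [g s >= 0], the increasing quotient exceeds some [k > 0] near [b], so [g > k * f] there. But
    [f] decays to zero linearly with slope [f' b < 0], while [g' b >= 0] leaves [g] at most
    [e * (b - t)] for small [e]. This avoids computing the limit of the quotient at [b]. *)
Lemma other_neg_after_largest_zero : 0 <= g' b -> negative_on x0 b g.
Proof.
move=> g'b s; rewrite in_itv/= => /andP[x0s sb]; have /andP[ax0 x0b] := x0ab.
rewrite ltNge; apply/negP => gs.
(* Moving right of [s] turns the weak inequality on the quotient into [k > 0]. *)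
pose s' := (s + b) / 2.
have ss' : s < s' by rewrite /s'; lra.
have s'b : s' < b by rewrite /s'; lra.
have f's := f'b.
pose k := g s' / f s'.
have k0 : 0 < k.
  apply: le_lt_trans (quotient_increasing s s' x0s ss' s'b).
  by rewrite divr_ge0// ltW// pos_after_largest_zero.
(* Chosen so that [e * (1 + k)] is half of [k * - f' b], which contradicts the inequality
   [k * (- f' b - e) < e] derived below. *)
pose e := k * - f' b / (2 * (1 + k)).
have e0 : 0 < e by apply: divr_gt0; apply: mulr_gt0; lra.
have eE : e * (1 + k) = k * - f' b / 2 by rewrite /e; field; rewrite gt_eqF//; lra.
have bab : b \in `[a, b] by rewrite in_itv/= (ltW ab) lexx.
have [c1 /andP[_ c1b] H1] := near_right_end f e fb e0 (df b bab).
have [c2 /andP[_ c2b] H2] := near_right_end g e gb e0 (dg b bab).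
pose M := Order.max s' (Order.max c1 c2); pose t := (M + b) / 2.
have Mb : M < b by rewrite !gt_max s'b c1b.
have tb : t < b by rewrite /t; lra.
have : M < t by rewrite /t; lra.
rewrite !gt_max => /andP[s't /andP[c1t c2t]].
have [ft _] := H1 t c1t tb; have [_ gt] := H2 t c2t tb.
have := quotient_increasing s' t ltac:(lra) s't tb.
have ft0 := pos_after_largest_zero t ltac:(lra) tb.
rewrite -/k ltr_pdivlMr// => kt.
have bt : 0 < b - t by lra.
have kf : k * ((- f' b - e) * (b - t)) <= k * f t by rewrite ler_pM2l.
have gg : (- g' b + e) * (b - t) <= e * (b - t) by rewrite ler_pM2r//; lra.
have : k * (- f' b - e) < e.
  by rewrite -(ltr_pM2r bt) -mulrA; lra.
have := mulr_gt0 k0 (ltac:(lra) : 0 < - f' b); lra.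
Qed.

(** Existence comes from the intermediate value theorem, [g] being negative at [x0] and positive
    near [b]. Two zeros of [g] would give the strictly increasing quotient the value [0] twice. *)
Lemma other_vanishes_once_after_largest_zero :
  g' b < 0 -> vanishes_once x0 b g.
Proof.
move=> g'b; have /andP[ax0 x0b] := x0ab.
have bab : b \in `[a, b] by rewrite in_itv/= (ltW ab) lexx.
have e0 : 0 < - g' b / 2 by lra.
have [c /andP[_ cb] Hc] := near_right_end g _ gb e0 (dg b bab).
pose M := Order.max x0 c; pose t := (M + b) / 2.
have Mb : M < b by rewrite !gt_max x0b.
have tb : t < b by rewrite /t; lra.
have : M < t by rewrite /t; lra.
rewrite !gt_max => /andP[x0t ct].
have gt0 : 0 < g t.
  have [+ _] := Hc t ct tb; apply: lt_le_trans; apply: mulr_gt0; lra.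
have gx0 := other_neg_at_largest_zero.
have [||z] := @IVT R g x0 t 0 (ltW x0t).
- apply: continuous_subspaceW gc => x /=; rewrite !in_itv/=; lra.
- by rewrite ge_min le_max (ltW gx0) (ltW gt0) orbT.
rewrite in_itv/= => /andP[x0z zt] gz.
have {}x0z : x0 < z.
  by rewrite lt_neqAle x0z andbT; apply/eqP => h; move: gx0; rewrite h gz ltxx.
exists z; split; first by rewrite in_itv/= x0z (le_lt_trans zt).
move=> w; rewrite in_itv/= => -[/andP[x0w wb] gw].
apply/eqP; case: (ltgtP z w) => // [zw|wz].
  by have := quotient_increasing z w x0z zw wb; rewrite gz gw !mul0r ltxx.
by have := quotient_increasing w z x0w wz ltac:(lra); rewrite gz gw !mul0r ltxx.
Qed.

End after_largest_zero.
End quotient.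

(** * Stability properties of absolute continuity *)

Section abs_continuity.
Context {R : realType}.
Implicit Types (a b : R) (f g h : R -> R).

Lemma abs_continuous_id a b : abs_continuous a b id.
Proof.
move=> e e0; exists e => // n u v uv _; apply: le_lt_trans.
by apply: ler_sum => i _; have [_ h _] := uv i; rewrite ger0_norm ?subr_ge0.
Qed.

(** Common source of the closure properties below: each reduces to an estimate of a single
    increment. *)
Lemma abs_continuous_dominated a b M f g h : 0 <= M ->
  abs_continuous a b f -> abs_continuous a b g ->
  (forall u v, a <= u -> u <= v -> v <= b ->
    `|h v - h u| <= M * (`|f v - f u| + `|g v - g u|)) ->
  abs_continuous a b h.
Proof.
move=> M0 acf acg hfg e e0; pose k := e / (2 * (M + 1)).
have k0 : 0 < k by apply: divr_gt0 => //; apply: mulr_gt0; lra.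
have kE : 2 * (M + 1) * k = e by rewrite /k; field; rewrite gt_eqF//; lra.
have [df df0 Hf] := acf _ k0; have [dg dg0 Hg] := acg _ k0.
exists (Order.min df dg) => [|n u v uv tr]; first by rewrite lt_min df0.
rewrite lt_min => /andP[/(Hf n u v uv tr) + /(Hg n u v uv tr)].
set sf := \sum_(i < n) _; set sg := \sum_(i < n) _ => sfk sgk.
have : \sum_(i < n) `|h (v i) - h (u i)| <= M * (sf + sg).
  rewrite mulrDr !mulr_sumr -big_split/=; apply: ler_sum => i _.
  by rewrite -mulrDr; have [? ? ?] := uv i; exact: hfg.
move=> /le_lt_trans; apply; nra.
Qed.

Lemma abs_continuousW a b c f : c <= b ->
  abs_continuous a b f -> abs_continuous a c f.
Proof.
move=> cb acf e e0; have [d d0 Hd] := acf e e0.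
exists d => // n u v uv; apply: Hd => i; have [au uv' vc] := uv i.
by split => //; exact: le_trans cb.
Qed.

Lemma abs_continuousM a b f g M :
  (forall x, a <= x -> x <= b -> `|f x| <= M) ->
  (forall x, a <= x -> x <= b -> `|g x| <= M) ->
  abs_continuous a b f -> abs_continuous a b g ->
  abs_continuous a b (fun x => f x * g x).
Proof.
move=> fM gM acf acg.
apply: (abs_continuous_dominated a b `|M| f g) => // u v au uv vb.
have -> : f v * g v - f u * g u = f v * (g v - g u) + g u * (f v - f u) by ring.
apply: le_trans (ler_normD _ _) _; rewrite !normrM addrC mulrDr.
by apply: lerD; apply: ler_wpM2r => //; (apply: le_trans (ler_norm M));
  [apply: gM|apply: fM]; lra.
Qed.

Lemma abs_continuousD a b f g :
  abs_continuous a b f -> abs_continuous a b g ->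
  abs_continuous a b (fun x => f x + g x).
Proof.
move=> acf acg; apply: (abs_continuous_dominated a b 1 f g) => // u v _ _ _.
by rewrite mul1r opprD addrACA; exact: ler_normD.
Qed.

Lemma abs_continuousN a b f :
  abs_continuous a b f -> abs_continuous a b (fun x => - f x).
Proof.
move=> acf; apply: (abs_continuous_dominated a b 1 f f) => // u v _ _ _.
by rewrite mul1r -opprD normrN lerDl.
Qed.

Lemma lipschitz_abs_continuous a b M f :
  (forall u v, a <= u -> u <= v -> v <= b -> `|f v - f u| <= M * (v - u)) ->
  abs_continuous a b f.
Proof.
move=> fM; apply: (abs_continuous_dominated a b `|M| id id) => //.
1,2: exact: abs_continuous_id.
move=> u v au uv vb /=; apply: le_trans (fM u v au uv vb) _.
have vu : 0 <= v - u by rewrite subr_ge0.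
rewrite (ger0_norm vu); apply: le_trans (ler_wpM2r vu (ler_norm M)) _.
by rewrite ler_wpM2l// lerDl.
Qed.

Lemma within_continuous_bounded a b f : a <= b ->
  {within `[a, b], continuous f} ->
  exists M : R, forall x, a <= x -> x <= b -> `|f x| <= M.
Proof.
move=> ab fc; have [c _ Hc] := EVT_max ab fc; have [d _ Hd] := EVT_min ab fc.
exists (`|f c| + `|f d|) => x ax xb.
have xab : x \in `[a, b] by rewrite in_itv/= ax.
have := Hc x xab; have := Hd x xab.
have := ler_norm (f c); have := ler_norm (- f d); rewrite normrN.
have := normr_ge0 (f c); have := normr_ge0 (f d); rewrite ler_norml; lra.
Qed.

(** The continuous derivative is bounded on the segment, so the mean value theorem makes [f]
    Lipschitz. *)
Lemma derivable_on_abs_continuous a b f : a < b ->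
  (forall x, x \in `[a, b] -> derivable_on a b f x) ->
  {within `[a, b], continuous (deriv_on a b f)} ->
  abs_continuous a b f.
Proof.
move=> ab df f'c; have [M HM] := within_continuous_bounded a b _ (ltW ab) f'c.
apply: (lipschitz_abs_continuous a b M) => u v au uv vb.
have [x||c] := @MVT_segment R f (deriv_on a b f) u v uv.
- rewrite in_itv/= => /andP[ux xv].
  have xab : x \in `]a, b[ by rewrite in_itv/=; lra.
  by apply: derivable_on_is_derive => //; apply: df; exact: subset_itv_oo_cc.
- apply: continuous_subspaceW (derivable_on_continuous ab f df) => x /=.
  by rewrite !in_itv/=; lra.
rewrite in_itv/= => /andP[uc cv] ->.
by rewrite normrM (ger0_norm (_ : 0 <= v - u)) ?subr_ge0// ler_wpM2r ?subr_ge0// HM//; lra.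
Qed.

End abs_continuity.

(** * The Wronskian of the real and imaginary parts as an integral *)

Section wronskian.
Context {R : realType} (a b : R) (q r : R -> R) (lambda : R[i]) (y : R -> R[i]).
Local Notation mu := (@lebesgue_measure R).
Local Notation phi := (fun x => complex.Re (y x)).
Local Notation psi := (fun x => complex.Im (y x)).
Local Notation phi' := (deriv_on a b phi).
Local Notation psi' := (deriv_on a b psi).
Local Notation G := (fun x => \int[mu]_(t in `[a, x]) (r t * normc (y t) ^+ 2)).
Hypothesis ab : a < b.
Hypothesis rpc : piecewise_continuous a b r.
Hypothesis ydom : dirichlet_domain a b y.
Hypothesis yeq : satisfies_equation a b q r lambda y.

Lemma normc_sqr (z : R[i]) :
  normc z ^+ 2 = complex.Re z ^+ 2 + complex.Im z ^+ 2.
Proof. by case: z => u v /=; rewrite sqr_sqrtr// addr_ge0 ?sqr_ge0. Qed.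

Let dphi x : x \in `[a, b] -> derivable_on a b phi x.
Proof. by case: ydom => -[+ _ _] _ _ _; apply. Qed.

Let dpsi x : x \in `[a, b] -> derivable_on a b psi x.
Proof. by case: ydom => _ [+ _ _] _ _; apply. Qed.

Let bounded : exists M : R, forall x, a <= x -> x <= b ->
  [/\ `|phi x| <= M, `|psi x| <= M, `|phi' x| <= M, `|psi' x| <= M & `|r x| <= M].
Proof.
have [[_ cphi' _] [_ cpsi' _] _ _] := ydom.
have cphi := derivable_on_continuous ab _ dphi.
have cpsi := derivable_on_continuous ab _ dpsi.
have [M1 H1] := within_continuous_bounded a b _ (ltW ab) cphi.
have [M2 H2] := within_continuous_bounded a b _ (ltW ab) cpsi.
have [M3 H3] := within_continuous_bounded a b _ (ltW ab) cphi'.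
have [M4 H4] := within_continuous_bounded a b _ (ltW ab) cpsi'.
have [M5 H5] := piecewise_continuous_bounded R a b r ab rpc.
(* Absolute values make the sum dominate each of the five bounds. *)
exists (`|M1| + `|M2| + `|M3| + `|M4| + `|M5|) => x ax xb.
have := (H1 x ax xb, H2 x ax xb, H3 x ax xb, H4 x ax xb, H5 x ax xb).
move=> [[[[h1 h2] h3] h4] h5].
have := (ler_norm M1, ler_norm M2, ler_norm M3, ler_norm M4, ler_norm M5).
have := (normr_ge0 M1, normr_ge0 M2, normr_ge0 M3, normr_ge0 M4, normr_ge0 M5).
move=> [[[[p1 p2] p3] p4] p5] [[[[n1 n2] n3] n4] n5].
by split; lra.
Qed.

Lemma weight_bounded : exists M : R, forall x, a <= x -> x <= b ->
  `|r x * normc (y x) ^+ 2| <= M.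
Proof.
have [M HM] := bounded; exists (M * (M ^+ 2 + M ^+ 2)) => x ax xb.
have [h1 h2 _ _ h5] := HM x ax xb.
rewrite normrM ler_pM// normc_sqr ger0_norm ?addr_ge0 ?sqr_ge0//.
have sqrM (u : R) : `|u| <= M -> u ^+ 2 <= M ^+ 2.
  by rewrite ler_norml => /andP[h h']; nra.
by apply: lerD; exact: sqrM.
Qed.

Lemma wronskian_integral x : x \in `]a, b[ ->
  phi x * psi' x - phi' x * psi x = - complex.Im lambda * G x.
Proof.
rewrite in_itv/= => /andP[ax xb].
have [[s rc] _ _] := rpc; have [M HM] := bounded; have [N HN] := weight_bounded.
have [acphi acpsi ya _] := ydom.
have acphi' : abs_continuous a b phi' by case: acphi.
have acpsi' : abs_continuous a b psi' by case: acpsi.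
have {}acphi : abs_continuous a b phi.
  by case: acphi => d c _; exact: derivable_on_abs_continuous.
have {}acpsi : abs_continuous a b psi.
  by case: acpsi => d c _; exact: derivable_on_abs_continuous.
have wc t : t \in `]a, b[ -> t \notin s ->
    {for t, continuous (fun t => r t * normc (y t) ^+ 2)}.
  move=> tab ts.
  have tab' := subset_itv_oo_cc tab.
  have cphi : {for t, continuous phi}.
    apply/differentiable_continuous/derivable1_diffP.
    by have [] := derivable_on_is_derive ab _ _ tab (dphi t tab').
  have cpsi : {for t, continuous psi}.
    apply/differentiable_continuous/derivable1_diffP.
    by have [] := derivable_on_is_derive ab _ _ tab (dpsi t tab').
  have -> : (fun t => r t * normc (y t) ^+ 2) =
      (fun t => r t * (phi t ^+ 2 + psi t ^+ 2)).
    by apply/funext => u; rewrite normc_sqr.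
  apply: cvgM; first exact: rc.
  by apply: cvgD; apply: cvgM.
pose beta := complex.Im lambda.
(* The claim says that this function vanishes; it is zero at [a], and it is constant once its
   derivative is zero almost everywhere. *)
pose H x := phi x * psi' x + - (phi' x * psi x) + beta * G x.
have acH : abs_continuous a b H.
  apply: abs_continuousD; first apply: abs_continuousD; last first.
  - apply: (lipschitz_abs_continuous a b (`|beta| * N)) => u v au uv vb.
    rewrite -mulrBr normrM -mulrA ler_wpM2l//.
    exact: (finite_discontinuities_lipschitz ab wc HN).
  - apply/abs_continuousN/(abs_continuousM a b _ _ M) => // t /HM h /h[]//.
  - apply: (abs_continuousM a b _ _ M) => // t /HM h /h[]//.
have Ha : H a = 0.
  by rewrite /H ya set_itv1 Rintegral_set1 !mul0r !mulr0 oppr0 !addr0.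
have H'0 : {ae mu, forall t, t \in `]a, x[ -> is_derive t 1 H 0}.
  (* The discontinuities of [r] are discarded as a null set, so that [G] is differentiable at the
     remaining points. *)
  have aes : {ae mu, forall t, t \notin s}.
    have cs : countable [set` s] by exact/finite_set_countable/finite_seq.
    exists [set` s]; split => [||t /= /negP/negPn//].
      exact: countable_measurable.
    exact: countable_lebesgue_measure0.
  have ? := ae_filter_ringOfSetsType mu.
  apply: filterS2 yeq aes => t eqn ts; rewrite in_itv/= => /andP[at_ tx].
  have tab : t \in `]a, b[ by rewrite in_itv/=; lra.
  have tab' := subset_itv_oo_cc tab.
  have [[dphi' dpsi'] ] := eqn tab.
  have Dphi := derivable_on_is_derive ab _ _ tab (dphi t tab').
  have Dpsi := derivable_on_is_derive ab _ _ tab (dpsi t tab').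
  have {dphi'}Dphi' := derivable_on_is_derive ab _ _ tab dphi'.
  have {dpsi'}Dpsi' := derivable_on_is_derive ab _ _ tab dpsi'.
  have DG := finite_discontinuities_is_derive ab wc HN t tab ts.
  rewrite /cderiv_on /=.
  move: Dphi' Dpsi'; set p2 := deriv_on a b phi' t; set q2 := deriv_on a b psi' t.
  move=> Dphi' Dpsi' eqC.
  (* Real and imaginary parts of the equation. In [phi * psi'' - phi'' * psi] the terms with [q] and
     with the real part of [lambda] cancel, leaving [- beta * r * |y|^2], which the derivative of
     [beta * G] compensates. *)
  have [eR eI] : - p2 + q t * phi t = r t * (complex.Re lambda * phi t - beta * psi t) /\
      - q2 + q t * psi t = r t * (complex.Re lambda * psi t + beta * phi t).
    move: eqC; rewrite /beta; case: (y t) => u v; case: (lambda) => al be /=.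
    by move=> [h1 h2]; split; lra.
  rewrite /H; apply: is_derive_eq; rewrite /GRing.scale/= normc_sqr.
  nra.
have : H x = H a.
  apply: abs_continuous_eq H'0; first exact: ltW.
  exact: (abs_continuousW a b) (ltW xb) acH.
by rewrite Ha /H; lra.
Qed.

End wronskian.
Theorem lemma7 (R : realType) (a b : R) (q r : R -> R)
    (lambda : R[i]) (y : R -> R[i]) :
  let phi := fun x => complex.Re (y x) in
  let psi := fun x => complex.Im (y x) in
  let G := fun x =>
    \int[@lebesgue_measure R]_(t in `[a, x]) (r t * normc (y t) ^+ 2) in
  a < b ->
  piecewise_continuous a b q ->
  piecewise_continuous a b r ->
  non_definite a b q r ->
  complex_ghost a b q r lambda y ->
  0 < complex.Im lambda ->
  (forall x, x \in `]a, b[ -> G x < 0) ->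
  (exists2 x, x \in `]a, b[ & phi x = 0) ->
  (deriv_on a b phi b < 0 ->
     exists2 x0, largest_zero a b phi x0 &
     [/\ 0 < deriv_on a b psi b -> negative_on x0 b psi,
         deriv_on a b psi b < 0 -> vanishes_once x0 b psi &
         deriv_on a b psi b = 0 ->
           negative_on x0 b psi \/ vanishes_once x0 b psi]) /\
  (0 < deriv_on a b phi b ->
     exists2 x0, largest_zero a b phi x0 &
     [/\ deriv_on a b psi b < 0 -> positive_on x0 b psi,
         0 < deriv_on a b psi b -> vanishes_once x0 b psi &
         deriv_on a b psi b = 0 ->
           positive_on x0 b psi \/ vanishes_once x0 b psi]).
Proof.
move=> phi psi G ab _ rpc _ [[ydom yeq _] _] beta0 G0 phi0.
have dphi x : x \in `[a, b] -> derivable_on a b phi x.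
  by case: ydom => -[+ _ _] _ _ _; apply.
have dpsi x : x \in `[a, b] -> derivable_on a b psi x.
  by case: ydom => _ [+ _ _] _ _; apply.
have [phib psib] : phi b = 0 /\ psi b = 0.
  by case: ydom => _ _ _ yb; rewrite /phi /psi yb.
have W0 x : x \in `]a, b[ ->
    0 < phi x * deriv_on a b psi x - deriv_on a b phi x * psi x.
  move=> xab; rewrite (wronskian_integral _ _ _ _ _ _ ab rpc ydom yeq x xab).
  by rewrite mulNr oppr_gt0 nmulr_llt0//; [exact: G0].
split=> phi'b.
  have [x0 x0P] := largest_zero_exists ab dphi phib phi'b phi0.
  have neg := other_neg_after_largest_zero ab dphi dpsi phib psib W0 phi'b x0P.
  exists x0 => //; split=> psi'b.
  - exact/neg/ltW.
  - exact: (other_vanishes_once_after_largest_zero ab dphi dpsi phib psib W0 phi'b x0P).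
  (* The borderline case always falls under the first alternative, since [neg] requires only a weak
     inequality. *)
  - by left; apply: neg; rewrite psi'b.
have dN (f : R -> R) : (forall x, x \in `[a, b] -> derivable_on a b f x) ->
    forall x, x \in `[a, b] -> derivable_on a b (fun t => - f t) x.
  by move=> df x xab; apply: derivable_onN; exact: df.
have dNphi := dN _ dphi; have dNpsi := dN _ dpsi.
have bab : b \in `[a, b] by rewrite in_itv/= (ltW ab) lexx.
have Nphib : - phi b = 0 by rewrite phib oppr0.
have Npsib : - psi b = 0 by rewrite psib oppr0.
have Nphi'b : deriv_on a b (fun t => - phi t) b < 0.
  by rewrite (deriv_onN ab phi b bab (dphi b bab)) oppr_lt0.
(* The Wronskian is bilinear, hence unchanged when both functions change sign; the previous results
   apply to [- phi] and [- psi]. *)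
have WN0 x : x \in `]a, b[ ->
    0 < - phi x * deriv_on a b (fun t => - psi t) x -
        deriv_on a b (fun t => - phi t) x * - psi x.
  move=> xab; have xab' := subset_itv_oo_cc xab.
  rewrite (deriv_onN ab phi x xab' (dphi x xab')).
  by rewrite (deriv_onN ab psi x xab' (dpsi x xab')) !mulrNN; exact: W0.
have Nphi0 : exists2 x, x \in `]a, b[ & - phi x = 0.
  by have [x xab phix] := phi0; exists x => //; rewrite phix oppr0.
have [x0 x0P] := largest_zero_exists ab dNphi Nphib Nphi'b Nphi0.
have neg := other_neg_after_largest_zero ab dNphi dNpsi Nphib Npsib WN0 Nphi'b x0P.
have once :=
  other_vanishes_once_after_largest_zero ab dNphi dNpsi Nphib Npsib WN0 Nphi'b x0P.
rewrite (deriv_onN ab psi b bab (dpsi b bab)) in neg once.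
have pos : 0 <= - deriv_on a b psi b -> positive_on x0 b psi.
  by move=> /neg h x xab; rewrite -oppr_lt0; exact: h.
exists x0.
  case: x0P => x0ab /eqP; rewrite oppr_eq0 => /eqP x00 x0max.
  by split => // t tab phit; apply: x0max => //; rewrite phit oppr0.
split=> psi'b.
- by apply: pos; rewrite oppr_ge0 ltW.
- have [|z [[zab /eqP]]] := once; first by rewrite oppr_lt0.
  rewrite oppr_eq0 => /eqP psiz zu; exists z; split => // w [wab psiw].
  by apply: zu; rewrite psiw oppr0.
- by left; apply: pos; rewrite psi'b oppr0.
Qed.
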